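(* Let $N\ge4$ and let $C_N$ be the $N$-cycle with all nodes binary ($d_v=2$ for all $v\in[N]$). Then $(C_N,d)$ has the positive margins property. Moreover, its global Markov ideal $I_{\mathrm{gl}(C_N)}\subseteq\Bbbk[p_x:x\in[2]^N]$ ($\Bbbk$ a field) is radical.
   Context: Let $G$ be a finite simple undirected graph with vertex set $[N]=\{1,\dots,N\}$, $d=(d_v)_{v\in[N]}$ with integers $d_v\ge2$, $\mathcal X=\prod_v[d_v]$, and $x_W=(x_v)_{v\in W}$ for $W\subseteq[N]$. ($C_N$ has edges $\{i,i+1\}$, indices mod $N$.) Global Markov moves and ideal: consider all partitions $[N]=A\cup B\cup C$ into disjoint (possibly empty) sets such that every path in $G$ from a vertex of $A$ to a vertex of $B$ meets $C$, and all states $x_A,x'_A,x_B,x'_B,x_C$ of the respective subsets. $I_{\mathrm{gl}(G)}\subseteq\Bbbk[p_x:x\in\mathcal X]$ is the ideal generated by all the binomials $p_{x_Ax_Bx_C}p_{x'_Ax'_Bx_C}-p_{x_Ax'_Bx_C}p_{x'_Ax_Bx_C}$. $\mathcal B_{\mathrm{gl}(G)}\subset\mathbb Z^{\mathcal X}$ is the set of all corresponding moves $e_{x_Ax_Bx_C}+e_{x'_Ax'_Bx_C}-e_{x_Ax'_Bx_C}-e_{x'_Ax_Bx_C}$ ($e_x$ = unit vectors). Margins: $A_G$ is the integer matrix with $(A_Gu)_{W,y}=\sum_{x\in\mathcal X:\,x_W=y}u_x$ for every clique $W$ of $G$ and every $y\in\prod_{v\in W}[d_v]$. The fiber of $u\in\mathbb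 N^{\mathcal X}$ is $\{v\in\mathbb N^{\mathcal X}:A_Gv=A_Gu\}$ ($0\in\mathbb N$). A fiber is connected by $\mathcal B_{\mathrm{gl}(G)}$ if any two of its elements are joined by a finite sequence in $\mathbb N^{\mathcal X}$ whose consecutive differences lie in $\pm\mathcal B_{\mathrm{gl}(G)}$. $(G,d)$ has the positive margins property if, for every $u\in\mathbb N^{\mathcal X}$ such that all entries of $A_Gu$ are strictly positive, the fiber of $u$ is connected by $\mathcal B_{\mathrm{gl}(G)}$. *)

(* Defs.v *)
From HB Require Import structures.
From mathcomp Require Import all_boot all_order all_algebra.
From mathcomp Require Import mpoly.
From Stdlib Require Import Relation_Operators.

Set Implicit Arguments.
Unset Strict Implicit.
Unset Printing Implicit Defensive.

Import GRing.Theory.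

Local Open Scope ring_scope.

Section Ideals.

Variable R : comNzRingType.

Definition generated_ideal (S : R -> Prop) (f : R) : Prop :=
  exists2 s : seq (R * R),
    (forall p, p \in s -> S p.2) & f = \sum_(p <- s) p.1 * p.2.

Definition radical_ideal (I : R -> Prop) : Prop :=
  forall (f : R) (n : nat), (0 < n)%N -> I (f ^+ n) -> I f.

End Ideals.

(* Simple graphs on N vertices are symmetric irreflexive relations on 'I_N;
   vertices and states are numbered from 0. *)
Section Models.

Variables (N : nat) (e : rel 'I_N) (d : 'I_N -> nat).

Definition state := {dffun forall v : 'I_N, 'I_(d v)}.

(* As every d v is positive, each partial state x_W is the restriction of some
   x : state. Below, partial states are given by such extensions, of which
   only the values on W are used. *)
Definition agree (W : {set 'I_N}) (x y : state) : bool :=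
  [forall v in W, x v == y v].

(* x_A x_B x_C, for a partition of the vertices into A, B and C *)
Definition glue (A B : {set 'I_N}) (xA xB xC : state) : state :=
  [ffun v : 'I_N => if v \in A then xA v else if v \in B then xB v else xC v].

Definition separates (C A B : {set 'I_N}) : Prop :=
  forall (a : 'I_N) (p : seq 'I_N),
    a \in A -> path e a p -> last a p \in B -> has (mem C) (a :: p).

Definition separated_partition (A B C : {set 'I_N}) : Prop :=
  [/\ [disjoint A & B], [disjoint A & C], [disjoint B & C],
      A :|: B :|: C = [set: 'I_N] & separates C A B].

Definition unit_vec (x : state) : {ffun state -> int} :=
  [ffun y => (y == x)%:R].

Definition global_move (m : {ffun state -> int}) : Prop :=
  exists (A B C : {set 'I_N}) (xA xA' xB xB' xC : state),
    separated_partition A B C /\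
    m = unit_vec (glue A B xA xB xC) + unit_vec (glue A B xA' xB' xC)
        - unit_vec (glue A B xA xB' xC) - unit_vec (glue A B xA' xB xC).

Definition clique (W : {set 'I_N}) : bool :=
  [forall i in W, forall j in W, (i != j) ==> e i j].

(* (A_G u)_{W,y} *)
Definition margin (u : {ffun state -> nat}) (W : {set 'I_N}) (y : state) : nat :=
  (\sum_(x : state | agree W x y) u x)%N.

Definition same_fiber (u v : {ffun state -> nat}) : Prop :=
  forall (W : {set 'I_N}) (y : state), clique W -> margin v W y = margin u W y.

Definition move_step (u v : {ffun state -> nat}) : Prop :=
  exists2 m : {ffun state -> int}, global_move m &
    let diff : {ffun state -> int} := [ffun x => (v x)%:Z - (u x)%:Z] in
    diff = m \/ diff = - m.

Definition fiber_connected (u : {ffun state -> nat}) : Prop :=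
  forall v w : {ffun state -> nat}, same_fiber u v -> same_fiber u w ->
    clos_refl_trans _ move_step v w.

Definition positive_margins_property : Prop :=
  forall u : {ffun state -> nat},
    (forall (W : {set 'I_N}) (y : state), clique W -> (0 < margin u W y)%N) ->
    fiber_connected u.

Variable k : fieldType.

Definition pvar (x : state) : {mpoly k[#|{: state}|]} := 'X_(enum_rank x).

Definition global_binomial (f : {mpoly k[#|{: state}|]}) : Prop :=
  exists (A B C : {set 'I_N}) (xA xA' xB xB' xC : state),
    separated_partition A B C /\
    f = pvar (glue A B xA xB xC) * pvar (glue A B xA' xB' xC)
        - pvar (glue A B xA xB' xC) * pvar (glue A B xA' xB xC).

Definition global_ideal : {mpoly k[#|{: state}|]} -> Prop :=
  generated_ideal global_binomial.

End Models.
Arguments positive_margins_property {N} e d.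
Arguments global_ideal {N} e d k _.

Definition cycle_graph (N : nat) : rel 'I_N :=
  [rel i j | (j == ordS i) || (i == ordS j)].
Arguments cycle_graph : clear implicits.

Lemma cycle_graph_sym N : ssrbool.symmetric (cycle_graph N).
Proof. by move=> i j; rewrite /cycle_graph /= orbC. Qed.

Lemma cycle_graph_irr N : (1 < N)%N -> irreflexive (cycle_graph N).
Proof.
move=> N_gt1 i; rewrite /cycle_graph /= orbb; apply/negbTE/eqP => /(congr1 val) /= Ei.
have := ltn_ord i; rewrite leq_eqVlt => /orP[/eqP Si|Si].
  by move: Ei; rewrite Si modnn => i0; move: N_gt1; rewrite -Si i0.
by move: Ei; rewrite modn_small // => /n_Sn.
Qed.

Definition binary (N : nat) : 'I_N -> nat := fun=> 2%N.
Arguments binary : clear implicits.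

(* Main.v *)
Require Import Defs.
From HB Require Import structures.
From mathcomp Require Import all_boot all_order all_algebra.
From mathcomp Require Import mpoly.
From Stdlib Require Import Classical Relation_Operators.
From mathcomp Require Import zify.

Set Implicit Arguments.
Unset Strict Implicit.
Unset Printing Implicit Defensive.

Import Order.TTheory GRing.Theory Num.Theory.

(** Cutting the cycle at vertex 0 and splitting the rows of a table according to
    their value there turns rows into paths in two layered graphs with two nodes
    per layer. Tables with equal edge margins differ, in the group with value 0,
    by a circulation, which contains either a pair of internally disjoint paths
    with common ends, realized by one Markov move, or a 2x2 exchange inside one
    layer. The exchange is a product of two moves as soon as a path of one group
    meets a path of the other one to the left or to the right of the layer, and
    the absence of such meetings leaves at most three edges on which both
    parities [x_k + x_{k+1}] occur. Hence four such edges make the fiber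
    connected, and positive margins give [N >= 4] of them.

    For radicality let [f ^+ j] lie in the ideal. For a monomial with at most
    three edges of the above kind, the homomorphism killing the variables whose
    parities do not occur in it kills the ideal, so the monomial does not occur
    in [f]. The other monomials are determined modulo the ideal by their edge
    margins, so [f] lies in the ideal because the toric parametrization kills it. *)

(** * Splicing of paths given by bit sequences *)

Definition follow (p : nat -> bool) (k : nat) (c : bool) : nat -> bool :=
  fun m => if (m <= k)%N then p m else c.

Lemma follow_le p k c m : (m <= k)%N -> follow p k c m = p m.
Proof. by rewrite /follow => ->. Qed.

Lemma follow_last p k c : follow p k c k.+1 = c.
Proof. by rewrite /follow ltnn. Qed.

Definition prepend (c : bool) (k : nat) (p : nat -> bool) : nat -> bool :=
  fun m => if (m <= k)%N then c else p m.

Lemma prepend_head c k p : prepend c k p k = c.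
Proof. by rewrite /prepend leqnn. Qed.

Lemma prepend_gt c k p m : (k < m)%N -> prepend c k p m = p m.
Proof. by rewrite /prepend ltnNge => /negbTE->. Qed.

(** * Circulations in a layered graph with two nodes per layer *)

Section Circulation.

Local Open Scope ring_scope.

(** [D] is a signed flow on the arcs from [(k, a)] to [(k.+1, b)] and [V] the flow through the
    nodes. Below, [D] is the difference of two tables within the group with value 0. *)
Variables (N : nat) (D : nat -> bool -> bool -> int) (V : nat -> bool -> int).
Hypothesis V_out : forall k a, (k < N)%N -> V k a = D k a false + D k a true.
Hypothesis V_in : forall k b, (k < N)%N -> V k.+1 b = D k false b + D k true b.
Hypothesis V_sum : forall k a, (k <= N)%N -> V k (~~ a) = - V k a.
Hypothesis V_first : forall a, V 0 a = 0.
Hypothesis V_last : forall a, V N a = 0.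

(** Following [p] forwards and [q] backwards traverses a closed walk whose directions agree with the
    signs of [D]. *)
Definition conformal_cycle : Prop := exists i j (p q : nat -> bool),
  [/\ (i < j <= N)%N, p i = q i, p j = q j &
    forall k, (i <= k < j)%N -> 0 < D k (p k) (p k.+1) /\ D k (q k) (q k.+1) < 0].

(** The two paths end at opposite nodes, with positive flow through the end of [p] and hence
    negative flow through the end of [q], so both can go on with the same signs. Either they reach a
    common node, or the flow through the new end of [p] is positive again. At layer [N] the flow
    vanishes, so they must meet by then. *)
Lemma extend_conformal_cycle i k (p q : nat -> bool) :
  (i < k <= N)%N -> p i = q i -> q k = ~~ p k -> 0 < V k (p k) ->
  (forall m, (i <= m < k)%N -> 0 < D m (p m) (p m.+1) /\ D m (q m) (q m.+1) < 0) ->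
  conformal_cycle.
Proof.
move Er : (N - k)%N => r; elim: r k p q Er => [|r IH] k p q Er ik pqi pqk Vk Dpq.
  have Ek : k = N by clear -Er ik; lia.
  by rewrite Ek V_last ltxx in Vk.
have kN : (k < N)%N by clear -Er; lia.
have ki : (i <= k)%N by clear -ik; lia.
have kNw : (k <= N)%N := ltnW kN.
have step b c : 0 < D k (p k) b -> D k (q k) c < 0 ->
    forall m, (i <= m < k.+1)%N ->
    0 < D m (follow p k b m) (follow p k b m.+1) /\
    D m (follow q k c m) (follow q k c m.+1) < 0.
  move=> Db Dc m /andP[im]; rewrite ltnS leq_eqVlt => /orP[/eqP->|mk].
    by rewrite !follow_last !follow_le.
  by rewrite !follow_le ?(ltnW mk) //; apply: Dpq; rewrite im.
have Vp := V_out (p k) kN; have Vq := V_out (q k) kN.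
have Vpq : V k (q k) = - V k (p k) by rewrite pqk V_sum.
have close b : 0 < D k (p k) b -> D k (q k) b < 0 -> conformal_cycle.
  move=> Db Dc; exists i, k.+1, (follow p k b), (follow q k b); split.
  - by rewrite kN ltnS ki.
  - by rewrite !follow_le.
  - by rewrite !follow_last.
  - exact: step.
have open b : 0 < D k (p k) b -> D k (q k) (~~ b) < 0 -> conformal_cycle.
  move=> Db Dc; case: (ltP (D k (q k) b) 0) => [|qb]; first exact: close.
  (* Both arcs into [(k.+1, b)] are now nonnegative, and one of them is positive. *)
  have Vb : 0 < V k.+1 b.
    by rewrite V_in //; case: (p k) pqk Db => pqk Db; rewrite pqk /= in qb; clear -Db qb; lia.
  apply: (IH k.+1 (follow p k b) (follow q k (~~ b))); rewrite ?follow_last //.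
  - by clear -Er; lia.
  - by rewrite kN ltnS ki.
  - by rewrite !follow_le.
  - exact: step.
have [b Db] : exists b, 0 < D k (p k) b.
  by case: (ltP 0 (D k (p k) false)) => [|h]; [exists false|exists true; clear -h Vp Vk; lia].
case: (ltP (D k (q k) b) 0) => [|qb]; first exact: close.
apply: (open b) => //.
by case: b Db qb => Db qb /=; clear -Vq Vpq Vk qb; lia.
Qed.

(** At the first layer with nonzero node flow, a positive arc enters a positive node. Its tail
    carries zero flow, so the other arc out of it is negative. These two arcs start the two
    paths. *)
Lemma circulation_cases : conformal_cycle \/ (forall k a, (k <= N)%N -> V k a = 0).
Proof.
suff IH k : (k <= N)%N -> conformal_cycle \/ (forall m a, (m <= k)%N -> V m a = 0).
  exact: IH.
elim: k => [|k IH] kN; first by right=> m a; rewrite leqn0 => /eqP->.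
have [|V0] := IH (ltnW kN); first by left.
case: (eqVneq (V k.+1 true) 0) => [V1|V1].
  right=> m a; rewrite leq_eqVlt => /orP[/eqP->|]; last exact: V0.
  by case: a; rewrite // -[false]/(~~ true) V_sum // V1 oppr0.
left.
have [a Va] : exists a, 0 < V k.+1 a.
  case: (ltP 0 (V k.+1 true)) => [|h]; first by exists true.
  exists false; rewrite -[false]/(~~ true) V_sum //; clear -h V1; lia.
have [c Dc] : exists c, 0 < D k c a.
  rewrite V_in // in Va.
  by case: (ltP 0 (D k false a)) => [|h]; [exists false|exists true; clear -h Va; lia].
have Dc' : D k c (~~ a) < 0.
  by have := V_out c kN; rewrite V0 //; case: a {Va} Dc => /= Dc; clear -Dc; lia.
apply: (@extend_conformal_cycle k k.+1 (follow (fun=> c) k a) (follow (fun=> c) k (~~ a))).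
- by rewrite ltnSn.
- by rewrite !follow_le.
- by rewrite !follow_last.
- by rewrite follow_last.
move=> m; rewrite ltnS -eqn_leq => /eqP<-.
by rewrite !follow_last !follow_le.
Qed.

End Circulation.

(** * Meetings of paths from the two groups *)

Section Meeting.

(** [T] and [F] stand for the arcs used by the rows with value 1 and with value 0 at vertex 0. *)
Variables (n : nat) (T F : nat -> bool -> bool -> bool).
Hypothesis T_next : forall m a b, m.+1 < n -> T m a b -> exists c, T m.+1 b c.
Hypothesis F_next : forall m a b, m.+1 < n -> F m a b -> exists c, F m.+1 b c.
Hypothesis T_prev : forall m b c, m.+1 < n -> T m.+1 b c -> exists a, T m a b.
Hypothesis F_prev : forall m b c, m.+1 < n -> F m.+1 b c -> exists a, F m a b.

Definition both_parities m : bool :=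
  [exists a, T m a a || F m a a] && [exists a, T m a (~~ a) || F m a (~~ a)].

Definition meet k c : Prop := exists j (p q : nat -> bool),
  [/\ (k < j <= n), p k = c, q k = ~~ c, p j = q j &
    forall m, k <= m < j -> T m (p m) (p m.+1) /\ F m (q m) (q m.+1)].

Lemma meet_now k c x : k < n -> T k c x -> F k (~~ c) x -> meet k c.
Proof.
move=> kn Tc Fc; exists k.+1, (prepend c k (fun=> x)), (prepend (~~ c) k (fun=> x)).
split; rewrite ?prepend_head ?prepend_gt ?ltnSn // => m.
by rewrite ltnS -eqn_leq => /eqP<-; rewrite !prepend_head !prepend_gt.
Qed.

Lemma meet_prepend k c x :
  T k c x -> F k (~~ c) (~~ x) -> meet k.+1 x -> meet k c.
Proof.
move=> Tc Fc [j [p [q [kj pk qk pqj Hpq]]]].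
have kj' : k < j by case/andP: kj => /ltnW.
exists j, (prepend c k p), (prepend (~~ c) k q).
split; rewrite ?prepend_head ?prepend_gt //; first by case/andP: kj => _ ->; rewrite kj'.
move=> m /andP[]; rewrite leq_eqVlt => /orP[/eqP<- _|km mj].
  by rewrite !prepend_head !prepend_gt ?pk ?qk.
by rewrite !prepend_gt ?(leqW km) //; apply: Hpq; rewrite km.
Qed.

(** A common head of an arc of [T] from [c] and an arc of [F] from [~~ c] would be a meeting. As a
    layer has only two nodes, each side has a single continuation. *)
Lemma no_meet_det k c : k < n -> ~ meet k c ->
  (exists x, T k c x) -> (exists x, F k (~~ c) x) ->
  exists x, [/\ T k c x, F k (~~ c) (~~ x), T k c (~~ x) = false & F k (~~ c) x = false].
Proof.
move=> kn nm [x Tx] [y Fy].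
have nF z : T k c z -> F k (~~ c) z = false.
  by move=> Tz; apply/negP => Fz; apply: nm; exact: (meet_now kn Tz Fz).
have Ey : y = ~~ x.
  have [E|] := eqVneq y x; last by case: (x) (y) => [] [].
  by rewrite E nF in Fy.
exists x; split; rewrite -?Ey ?(nF x) //.
by apply/negP => Ty; rewrite nF in Fy.
Qed.

(** Once the groups occupy opposite nodes, each continues in one way only and they stay opposite.
    The arcs [(t, x)] and [(~~ t, ~~ x)] of a layer have the same parity. *)
Lemma split_no_meet k t : ~ meet k t ->
  (exists x, T k t x) -> (exists x, F k (~~ t) x) ->
  (forall x, T k (~~ t) x = false) -> (forall x, F k t x = false) ->
  forall m, k <= m < n -> both_parities m = false.
Proof.
move Er : (n - k) => r; elim: r k t Er => [|r IH] k t Er nm Tt Ft T0 F0 m.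
  by clear -Er; lia.
have kn : k < n by clear -Er; lia.
have [x [Tx Fx Tx0 Fx0]] := no_meet_det kn nm Tt Ft.
case/andP; rewrite leq_eqVlt => /orP[/eqP<- _|km mn].
  apply/negP => /andP[/existsP[a Ha] /existsP[b Hb]].
  by move: t x a b Tx Fx Tx0 Fx0 T0 F0 Ha Hb {Tt Ft nm}
    => [] [] [] [] /= Tx Fx Tx0 Fx0 T0 F0; rewrite ?Tx0 ?Fx0 ?T0 ?F0.
have kn1 : k.+1 < n by exact: leq_ltn_trans km mn.
apply: (IH k.+1 x); rewrite ?km //.
- by clear -Er; lia.
- by move=> H; apply: nm; exact: (meet_prepend Tx Fx H).
- exact: T_next kn1 Tx.
- exact: F_next kn1 Fx.
- move=> z; apply/negP => /(T_prev kn1)[a Ta].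
  by move: t a Tx0 T0 Ta {Tx Fx Fx0 F0 nm Tt Ft} => [] [] /= Tx0 T0; rewrite ?Tx0 ?T0.
- move=> z; apply/negP => /(F_prev kn1)[a Fa].
  by move: t a Fx0 F0 Fa {Tx Fx Tx0 T0 nm Tt Ft} => [] [] /= Fx0 F0; rewrite ?Fx0 ?F0.
Qed.

Lemma sum_bool_eq0 (B : nat -> bool) k r :
  (forall m, k <= m < r -> B m = false) -> \sum_(k <= m < r) B m = 0.
Proof. by move=> B0; rewrite big_nat big1 // => m /B0 ->. Qed.

(** By determinism [T] leads from [true] to [x] and from [false] to [y], while [F] leads from
    [false] to [~~ x] and from [true] to [~~ y]. If [x = y], the groups are split from the next
    layer on. Otherwise all arcs of the layer have the same parity and both groups occupy both nodes
    again. *)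
Lemma no_meet_both_parities k :
  (forall a, exists x, T k a x) -> (forall a, exists x, F k a x) ->
  (forall c, ~ meet k c) -> \sum_(k <= m < n) both_parities m <= 1.
Proof.
move Er : (n - k) => r; elim: r k Er => [|r IH] k Er HT HF nm.
  by rewrite big_geq //; clear -Er; lia.
have kn : k < n by clear -Er; lia.
have [x [Tx Fx Tx0 Fx0]] := no_meet_det kn (nm true) (HT true) (HF false).
have [y [Ty Fy Ty0 Fy0]] := no_meet_det kn (nm false) (HT false) (HF true).
rewrite big_ltn //.
case: (ltnP k.+1 n) => [kn1|nk]; last by rewrite (big_geq nk) addn0 leq_b1.
have [Exy|Exy] := eqVneq x y.
  subst y; rewrite sum_bool_eq0 ?addn0 ?leq_b1 //.
  apply: (@split_no_meet _ x).
  - by move=> H; apply: (nm true); exact: (meet_prepend Tx Fx H).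
  - exact: T_next kn1 Tx.
  - exact: F_next kn1 Fx.
  - by move=> z; apply/negP => /(T_prev kn1)[[]]; rewrite ?Tx0 ?Ty0.
  - by move=> z; apply/negP => /(F_prev kn1)[[]]; rewrite ?Fx0 ?Fy0.
have Ey : y = ~~ x by move: Exy; case: (x) (y) => [] [].
subst y; rewrite negbK in Fy Ty0.
have -> : both_parities k = false.
  apply/negP => /andP[/existsP[a Ha] /existsP[b Hb]].
  by case: x a b Tx Fx Tx0 Fx0 Ty Fy Ty0 Fy0 Ha Hb {Exy}
    => [] [] [] /= Tx Fx Tx0 Fx0 Ty Fy Ty0 Fy0; rewrite ?Tx0 ?Fx0 ?Ty0 ?Fy0.
apply: IH.
- by clear -Er; lia.
- move=> a; have [<-|Ea] := eqVneq x a; first exact: T_next kn1 Tx.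
  by have <- : ~~ x = a; [by move: Ea; case: (x) (a) => [] []|]; exact: T_next kn1 Ty.
- move=> a; have [<-|Ea] := eqVneq x a; first exact: F_next kn1 Fy.
  by have <- : ~~ x = a; [by move: Ea; case: (x) (a) => [] []|]; exact: F_next kn1 Fx.
move=> c H; have [Ec|Ec] := eqVneq x c.
  by subst c; apply: (nm true); exact: (meet_prepend Tx Fx H).
have Ecx : c = ~~ x by move: Ec; case: (x) (c) => [] [].
subst c; apply: (nm false); apply: (meet_prepend Ty _ H); first by rewrite negbK.
Qed.

End Meeting.
Lemma hasP_perm (T : eqType) (a : pred T) s : has a s ->
  exists x s', a x /\ perm_eq s (x :: s').
Proof. by case/hasP=> x xs ax; exists x, (rem x s); split=> //; exact: perm_to_rem. Qed.

Lemma ltn_sum_ex (I : finType) (F G : I -> nat) i0 :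
  (forall i, F i <= G i) -> F i0 < G i0 -> \sum_i F i < \sum_i G i.
Proof.
move=> FG FG0; rewrite (bigD1 i0) //= [X in _ < X](bigD1 i0) //= -addSn.
by apply: leq_add => //; apply: leq_sum.
Qed.

(** * Tables as lists of rows, and swaps of arcs *)

Section Rows.

Variable n : nat.
Local Notation N := n.+1.
Local Notation row := (state (binary N)).

Implicit Types (x y : row) (s t : seq row) (k : nat) (c : bool * bool).

(** Positions are read modulo [N], so that the closing edge of the cycle is [cell x n] and layer [N]
    is vertex 0 again. *)
Definition bit x k : bool := nat_of_ord (x (inZp k)) == 1.

Definition cell x k : bool * bool := (bit x k, bit x k.+1).

Lemma bit_mod x k : bit x (k %% N) = bit x k.
Proof. by rewrite /bit; congr (nat_of_ord (x _) == 1); apply: val_inj; rewrite /= modn_mod. Qed.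

Lemma bitN x : bit x N = bit x 0.
Proof. by rewrite -bit_mod modnn. Qed.

Lemma bit_val x (v : 'I_N) : bit x v = (x v == 1 :> nat).
Proof. by rewrite /bit; congr (nat_of_ord (x _) == 1); apply: val_inj; rewrite /= modn_small. Qed.

Lemma bit_eq x y (v : 'I_N) : (bit x v = bit y v) <-> (x v = y v).
Proof.
rewrite !bit_val; split=> [|->] // H; apply: val_inj.
by move: H (ltn_ord (x v)) (ltn_ord (y v)) => /=; do 2 case: (nat_of_ord _) => [|[|?]].
Qed.

Lemma eq_bits x y : (forall k, k < N -> bit x k = bit y k) -> x = y.
Proof. by move=> H; apply/ffunP => v; apply/bit_eq/H. Qed.

(** If [x] and [y] agree at [i] and [j], replacing them by the two swaps is a global Markov move
    that separates the interior of the arc from the outside by its ends. *)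
Definition swap_arc (i j : nat) x y : row :=
  [ffun v : 'I_N => if i < v < j then y v else x v].

Lemma swap_arcE i j x y (v : 'I_N) :
  swap_arc i j x y v = if i < v < j then y v else x v.
Proof. by rewrite /swap_arc ffunE. Qed.

Lemma bit_swap i j x y k : j <= N -> k <= N ->
  bit (swap_arc i j x y) k = if i < k < j then bit y k else bit x k.
Proof.
move=> jN; rewrite leq_eqVlt => /orP[/eqP->|kN].
  have -> : (i < N < j) = false by rewrite [N < j]ltnNge jN andbF.
  by rewrite !bitN /bit swap_arcE.
by rewrite /bit swap_arcE /= modn_small //; case: ifP.
Qed.

Lemma swap_arcK i j x y : swap_arc i j (swap_arc i j x y) (swap_arc i j y x) = x.
Proof. by apply/ffunP => v; rewrite !swap_arcE; case: (_ && _). Qed.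

Lemma cell_swap i j x y k : i < j <= N -> k < N -> bit x i = bit y i -> bit x j = bit y j ->
  cell (swap_arc i j x y) k = if i <= k < j then cell y k else cell x k.
Proof.
move=> /andP[ij jN] kN xyi xyj; rewrite /cell !bit_swap // ?(ltnW kN) // ltnS.
case: (boolP (i <= k < j)) => [/andP[ik kj]|out].
  congr (_, _); rewrite ?ik ?kj ?andbT /=.
    by move: ik; rewrite leq_eqVlt => /orP[/eqP<-|->] //; rewrite ltnn.
  by move: kj; rewrite leq_eqVlt => /orP[/eqP->|->] //; rewrite ltnn.
congr (_, _); rewrite ifN //; apply: contraNN out => /andP[ik kj].
  by rewrite (ltnW ik).
by rewrite ik (ltnW kj).
Qed.

(** Lists of rows stand for tables. Permutations make the order irrelevant, so a swap need only act
    on the first two rows. *)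
Inductive conn : seq row -> seq row -> Prop :=
| conn_perm s t : perm_eq s t -> conn s t
| conn_swap i j x y s : i < j <= N -> bit x i = bit y i -> bit x j = bit y j ->
    conn [:: x, y & s] [:: swap_arc i j x y, swap_arc i j y x & s]
| conn_trans s t r : conn s t -> conn t r -> conn s r.

Lemma conn_refl s : conn s s.
Proof. exact: conn_perm. Qed.

Lemma conn_cons x s t : conn s t -> conn (x :: s) (x :: t).
Proof.
elim=> {s t} [s t st|i j y z s ij yzi yzj|s t r _ st _ tr].
- by apply: conn_perm; rewrite perm_cons.
- apply: conn_trans (conn_trans (conn_perm _) (conn_swap (x :: s) ij yzi yzj)) (conn_perm _).
    by rewrite (perm_catCA [:: x] [:: y; z] s).
  by rewrite (perm_catCA [:: _; _] [:: x] s).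
- exact: conn_trans st tr.
Qed.

Lemma conn_sym s t : conn s t -> conn t s.
Proof.
elim=> {s t} [s t st|i j x y s ij xyi xyj|s t r _ st _ tr].
- by apply: conn_perm; rewrite perm_sym.
- rewrite -[in X in conn _ X](swap_arcK i j x y) -[in y :: s](swap_arcK i j y x).
  have [i_N j_N] : i <= N /\ j <= N.
    by clear -ij; lia.
  by apply: conn_swap; rewrite // !bit_swap ?ltnn ?andbF //; clear -ij; lia.
- exact: conn_trans tr st.
Qed.

(* [edge_count s k (a, b)] is the margin at the edge [{k, k+1}]; [layer_count]
   refines it by the value at vertex 0, which turns a row into a path in a
   layered graph with two nodes [(k, 0)] and [(k, 1)] in each layer. *)
Definition edge_count s k c : nat := count (fun x => cell x k == c) s.

Definition layer_count s (g : bool) k c : nat :=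
  count (fun x => (bit x 0 == g) && (cell x k == c)) s.

Lemma layer_count_cons x s g k c :
  layer_count (x :: s) g k c = ((bit x 0 == g) && (cell x k == c)) + layer_count s g k c.
Proof. by []. Qed.

Lemma edge_count_layers s k c :
  edge_count s k c = layer_count s true k c + layer_count s false k c.
Proof.
rewrite /edge_count /layer_count; elim: s => //= x s ->.
by case: (bit x 0); case: (cell x k == c) => /=; lia.
Qed.

Lemma conn_edge_count s t k c : k < N -> conn s t -> edge_count s k c = edge_count t k c.
Proof.
move=> kN; elim=> {s t} [s t /permP E|i j x y s ij xyi xyj|s t r _ -> _ ->] //.
  exact: E.
rewrite /edge_count /= !cell_swap //.
by case: ifP => // _; clear; lia.
Qed.

Lemma perm_layer_count s t g k c : perm_eq s t -> layer_count s g k c = layer_count t g k c.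
Proof. by move=> /permP E; exact: E. Qed.

Lemma layer_swap i j x y s g k c : i < j <= N -> bit x i = bit y i -> bit x j = bit y j ->
  bit x 0 = bit y 0 -> k < N ->
  layer_count [:: swap_arc i j x y, swap_arc i j y x & s] g k c = layer_count [:: x, y & s] g k c.
Proof.
move=> ij xyi xyj xy0 kN; have jN : j <= N by clear -ij; lia.
rewrite /layer_count /= !cell_swap // !bit_swap //= xy0.
by case: ifP => // _; clear; lia.
Qed.

(** Arcs are attached one at a time. A row following [p] up to [j] and a row of the same group
    through the next arc agree at [j] and at vertex 0, so their tails from [j] to [N] can be swapped
    without changing any layer count. *)
Lemma realize_path s g i j (p : nat -> bool) : i < j <= N ->
  (forall k, i <= k < j -> 0 < layer_count s g k (p k, p k.+1)) ->
  exists x s', [/\ conn s (x :: s'), bit x 0 = g,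
    (forall g' k c, k < N -> layer_count (x :: s') g' k c = layer_count s g' k c) &
    forall k, i <= k <= j -> bit x k = p k].
Proof.
elim: j => // j IH /andP[]; rewrite ltnS leq_eqVlt => /orP[/eqP Eij|ij] jN Hp.
  subst i; have := Hp j; rewrite leqnn ltnSn -has_count => /(_ isT)/hasP_perm.
  case=> x [s' [/andP[/eqP x0 /eqP[xj xj1]] ss']]; exists x, s'; split=> //.
  - exact: conn_perm.
  - by move=> g' k c _; rewrite (perm_layer_count g' k c ss').
  - move=> k /andP[jk]; rewrite leq_eqVlt ltnS => /orP[/eqP->|kj] //.
    by have -> : k = j by apply/eqP; rewrite eqn_leq kj.
have [x [s' [ss' x0 Ms' xp]]] : exists x s', [/\ conn s (x :: s'), bit x 0 = g,
    (forall g' k c, k < N -> layer_count (x :: s') g' k c = layer_count s g' k c) &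
    forall k, i <= k <= j -> bit x k = p k].
  apply: IH; first by rewrite ij ltnW.
  by move=> k /andP[ik kj]; apply: Hp; rewrite ik ltnS ltnW.
have jj : i <= j < j.+1 by rewrite (ltnW ij) ltnSn.
have := Hp j jj; rewrite -Ms' // layer_count_cons.
case: (boolP ((bit x 0 == g) && _)) => [/andP[_ /eqP[_ xj1]] _|_].
  exists x, s'; split=> // k /andP[ik]; rewrite leq_eqVlt ltnS => /orP[/eqP->|kj] //.
  by apply: xp; rewrite ik.
rewrite add0n -has_count => /hasP_perm[y [s2 [/andP[/eqP y0 /eqP[yj yj1]] s's2]]].
have xj : bit x j = bit y j by rewrite yj xp // (ltnW ij) leqnn.
have xN : bit x N = bit y N by rewrite !bitN x0 y0.
have jNN : j < N <= N by rewrite leqnn andbT.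
have xys2 : perm_eq (x :: s') [:: x, y & s2] by rewrite perm_cons.
exists (swap_arc j N x y), (swap_arc j N y x :: s2); split.
- apply: conn_trans ss' (conn_trans (conn_perm xys2) _); exact: conn_swap.
- by rewrite bit_swap.
- move=> g' k c kN; rewrite layer_swap // ?x0 ?y0 // -Ms' //.
  by rewrite (perm_layer_count _ _ _ xys2).
move=> k /andP[ik kj]; have kN : k <= N by apply: leq_trans kj _.
rewrite bit_swap //; move: kj; rewrite leq_eqVlt ltnS => /orP[/eqP Ek|kj].
  (* A swap leaves position [N] alone. If [j.+1 = N], the value required there is that at vertex 0,
     which both rows share. *)
  subst k; rewrite ltnSn /=; move: kN; rewrite leq_eqVlt => /orP[/eqP Ej|->] //.
  by rewrite [j.+1 < N]ltn_neqAle Ej eqxx /= xN -Ej.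
by rewrite ltnNge kj /=; apply: xp; rewrite ik.
Qed.

(** A row of [s] is a path with positive counts, hence it can be realized in [t] and cancelled. *)
Lemma layer_count_conn s t :
  (forall g k c, k < N -> layer_count s g k c = layer_count t g k c) -> conn s t.
Proof.
elim: s t => [|x s IH] t Hst.
  case: t Hst => [|y t] Hst; first exact: conn_refl.
  by have := Hst (bit y 0) 0 (cell y 0) isT; rewrite layer_count_cons !eqxx.
have [||y [t' [tt' y0 Mt' yx]]] := @realize_path t (bit x 0) 0 N (bit x).
- by rewrite leqnn.
- by move=> k /andP[_ kN]; rewrite -Hst // layer_count_cons !eqxx.
have Eyx : y = x.
  by apply: eq_bits => k kN; apply: yx; rewrite /= ltnW.
subst y; apply: conn_trans (conn_sym tt'); apply: conn_cons; apply: IH => g k c kN.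
by have := Mt' g k c kN; rewrite -Hst // !layer_count_cons => /addnI.
Qed.

Definition on_path i j (p : nat -> bool) k c : bool := (i <= k < j) && ((p k, p k.+1) == c).

(* Swapping an arc on which two rows from different groups follow [p] and [q]. *)
Lemma augment s i j (p q : nat -> bool) : i < j <= N -> p i = q i -> p j = q j ->
  (forall k, i <= k < j -> 0 < layer_count s true k (p k, p k.+1)) ->
  (forall k, i <= k < j -> 0 < layer_count s false k (q k, q k.+1)) ->
  exists2 s', conn s s' & forall k c, k < N ->
    layer_count s' false k c + on_path i j q k c = layer_count s false k c + on_path i j p k c.
Proof.
move=> ij pqi pqj Hp Hq.
have [x [s1 [ss1 x0 Ms1 xp]]] := realize_path ij Hp.
(* The row [x] belongs to the group with value 1, so taking it away leaves the counts of the other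
   group. *)
have Hq1 k : i <= k < j -> 0 < layer_count s1 false k (q k, q k.+1).
  move=> ikj; have kN : k < N by clear -ij ikj; lia.
  by move: (Hq k ikj); rewrite -Ms1 // layer_count_cons x0.
have [y [s2 [ss2 y0 Ms2 yq]]] := realize_path ij Hq1.
have iij : i <= i <= j.
  by clear -ij; lia.
have ijj : i <= j <= j.
  by clear -ij; lia.
have jN : j <= N.
  by clear -ij; lia.
have xyi : bit x i = bit y i by rewrite xp // yq.
have xyj : bit x j = bit y j by rewrite xp // yq.
exists [:: swap_arc i j x y, swap_arc i j y x & s2].
  exact: conn_trans ss1 (conn_trans (conn_cons x ss2) (conn_swap _ ij xyi xyj)).
move=> k c kN; rewrite -Ms1 // [layer_count (x :: s1) _ _ _]layer_count_cons x0 /= -Ms2 //.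
rewrite !layer_count_cons !bit_swap // !cell_swap // x0 y0 /= /on_path.
case: (boolP (i <= k < j)) => //= /andP[ik kj].
have Ex : cell x k = (p k, p k.+1) by rewrite /cell !xp //; clear -ik kj; lia.
have Ey : cell y k = (q k, q k.+1) by rewrite /cell !yq //; clear -ik kj; lia.
rewrite Ex Ey; move: (_ == c) (_ == c) (layer_count _ _ _ _) => u v w; clear; lia.
Qed.


Local Notation step p k := (p k, p k.+1) (only parsing).

(* Composes two augmentations that undo each other outside layer [l]. *)
Lemma double_augment s i j l (p1 q1 p2 q2 : nat -> bool) :
  i < j <= N -> i <= l < j ->
  p1 i = q1 i -> p1 j = q1 j -> p2 i = q2 i -> p2 j = q2 j ->
  (forall k, i <= k < j -> k != l -> step p2 k = step q1 k /\ step q2 k = step p1 k) ->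
  step p1 l != step p2 l -> step q1 l != step q2 l ->
  (forall k, i <= k < j -> 0 < layer_count s true k (step p1 k)) ->
  (forall k, i <= k < j -> 0 < layer_count s false k (step q1 k)) ->
  0 < layer_count s true l (step p2 l) -> 0 < layer_count s false l (step q2 l) ->
  exists2 s', conn s s' & forall k c, k < N ->
    layer_count s' false k c + (k == l) * ((step q1 l == c) + (step q2 l == c)) =
    layer_count s false k c + (k == l) * ((step p1 l == c) + (step p2 l == c)).
Proof.
move=> ij il pqi pqj pqi' pqj' Epq np nq Tp1 Fq1 Tp2 Fq2.
have ijN k : i <= k < j -> k < N by move=> H; clear -H ij; lia.
have [s1 ss1 F1] := augment ij pqi pqj Tp1 Fq1.
(* Edge margins are preserved, so the group with value 1 changes by the opposite amount. *)
have T1 k c : k < N ->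
    layer_count s1 true k c + on_path i j p1 k c = layer_count s true k c + on_path i j q1 k c.
  move=> kN; have := F1 k c kN; have := conn_edge_count c kN ss1.
  by rewrite !edge_count_layers; clear; lia.
have [||s2 s12 F2] := @augment s1 i j p2 q2 ij pqi' pqj'.
(* Off layer [l] the first augmentation provides the arcs required now. In layer [l] it removes only
   an arc different from the required one. *)
- move=> k ijk; have [->|kl] := eqVneq k l.
    have := T1 l (step p2 l) (ijN _ il); rewrite /on_path il (negbTE np).
    by move: Tp2; clear; lia.
  have [-> _] := Epq k ijk kl; have := T1 k (step q1 k) (ijN _ ijk).
  rewrite /on_path ijk eqxx /=; case: eqP => [E|_]; last by clear; lia.
  by have := Tp1 k ijk; rewrite E; clear; lia.
- move=> k ijk; have [->|kl] := eqVneq k l.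
    have := F1 l (step q2 l) (ijN _ il); rewrite /on_path il (negbTE nq).
    by move: Fq2; clear; lia.
  have [_ ->] := Epq k ijk kl; have := F1 k (step p1 k) (ijN _ ijk).
  rewrite /on_path ijk eqxx /=; case: eqP => [E|_]; last by clear; lia.
  by have := Fq1 k ijk; rewrite E; clear; lia.
exists s2; first exact: conn_trans ss1 s12.
move=> k c kN; have := F1 k c kN; have := F2 k c kN; rewrite /on_path.
have [->|kl] := eqVneq k l; first by rewrite il /=; clear; lia.
case: (boolP (i <= k < j)) => [ijk|_] /=; last by clear; lia.
by have [-> ->] := Epq k ijk kl; clear; lia.
Qed.

Definition cross s l a b : Prop :=
  [/\ 0 < layer_count s true l (a, b), 0 < layer_count s true l (~~ a, ~~ b),
      0 < layer_count s false l (a, ~~ b) & 0 < layer_count s false l (~~ a, b)].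

Definition cross_exchangeable s l a b : Prop :=
  exists2 s', conn s s' & forall k c, k < N ->
    layer_count s' false k c + (k == l) * (((a, ~~ b) == c) + ((~~ a, b) == c)) =
    layer_count s false k c + (k == l) * (((a, b) == c) + ((~~ a, ~~ b) == c)).

Lemma cross_flip s l a b : cross s l a b -> cross s l (~~ a) (~~ b).
Proof. by case=> *; split; rewrite ?negbK. Qed.

Lemma cross_exchangeable_flip s l a b :
  cross_exchangeable s l (~~ a) (~~ b) -> cross_exchangeable s l a b.
Proof.
case=> s' ss' H; exists s' => // k c kN; have := H k c kN; rewrite !negbK.
by rewrite [(_ == c) + _ in X in X = _ -> _]addnC [(_ == c) + _ in X in _ = X -> _]addnC.
Qed.

Definition layer_pos s g k a b : bool := 0 < layer_count s g k (a, b).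

Lemma layer_posP s g k a b : reflect
  (exists2 x, x \in s & [/\ bit x 0 = g, bit x k = a & bit x k.+1 = b]) (layer_pos s g k a b).
Proof.
rewrite /layer_pos /layer_count -has_count.
apply: (iffP hasP) => [[x xs /andP[/eqP x0 /eqP[xa xb]]]|[x xs [<- <- <-]]]; exists x => //.
by rewrite !eqxx.
Qed.

Lemma layer_pos_next s g k a b : layer_pos s g k a b -> exists d, layer_pos s g k.+1 b d.
Proof.
by case/layer_posP=> x xs [x0 _ xb]; exists (bit x k.+2); apply/layer_posP; exists x.
Qed.

Lemma layer_pos_prev s g k b d : layer_pos s g k.+1 b d -> exists a, layer_pos s g k a b.
Proof.
by case/layer_posP=> x xs [x0 xb _]; exists (bit x k); apply/layer_posP; exists x.
Qed.

(** The first augmentation leads from [(l, a)] through [b] and [~~ b] along the meeting paths. The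
    groups have then traded these paths, and the second augmentation, from [(l, ~~ a)], trades them
    back. Only the four arcs of layer [l] remain exchanged. *)
Lemma cross_exchange_right s l a b : l < N -> cross s l a b ->
  meet N (layer_pos s true) (layer_pos s false) l.+1 b -> cross_exchangeable s l a b.
Proof.
move=> lN [Tab Tab' Fab Fab'] [j [p [q [/andP[lj jN] pl ql pqj Hpq]]]].
have ll : l <= l < j by rewrite leqnn ltnW.
have lj1 : l < j := ltnW lj.
have nab (x y : bool) (z t : bool) : x != y -> (x, z) != (y, t).
  by apply: contraNN => /eqP[->].
have [|||||||||||||s' ss' H] := @double_augment s l j l
  (prepend a l p) (prepend a l q) (prepend (~~ a) l q) (prepend (~~ a) l p).
all: rewrite ?prepend_head ?prepend_gt ?pl ?ql ?lj1 ?leqnn //.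
- move=> k /andP[lk kj] kl.
  have {}lk : l < k by rewrite ltn_neqAle eq_sym kl.
  by rewrite !prepend_gt // leqW.
- by apply: nab; case: (a).
- by apply: nab; case: (a).
- move=> k /andP[]; rewrite leq_eqVlt => /orP[/eqP<- _|lk kj].
    by rewrite prepend_head prepend_gt ?pl.
  by rewrite !prepend_gt ?(leqW lk) //; case: (Hpq k); rewrite ?lk.
- move=> k /andP[]; rewrite leq_eqVlt => /orP[/eqP<- _|lk kj].
    by rewrite prepend_head prepend_gt ?ql.
  by rewrite !prepend_gt ?(leqW lk) //; case: (Hpq k); rewrite ?lk.
exists s' => // k c kN; have := H k c kN.
by rewrite !prepend_head !prepend_gt ?pl ?ql.
Qed.

(** The layers to the left of [l] are read from right to left, so that the results on [meet] also
    cover paths going left. *)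
Definition layer_pos_rev s g l m a b : bool := layer_pos s g (l - m.+1) b a.

(** Mirror image of the exchange on the right: both augmentations start where the paths meet, at
    layer [l - j], and they end in layer [l.+1] at [b] and at [~~ b]. *)
Lemma cross_exchange_left s l a b : l < N -> cross s l a b ->
  meet l (layer_pos_rev s true l) (layer_pos_rev s false l) 0 a -> cross_exchangeable s l a b.
Proof.
move=> lN [Tab Tab' Fab Fab'] [j [p [q [/andP[j0 jl] p0 q0 pqj Hpq]]]].
have lj : l - (l - j) = j by rewrite subKn.
have ljl : l - j <= l by rewrite leq_subr.
have nab (x y : bool) (z t : bool) : z != t -> (x, z) != (y, t).
  by apply: contraNN => /eqP[_ ->].
have [|||||||||||||s' ss' H] := @double_augment s (l - j) l.+1 l
  (follow (fun m => p (l - m)) l b) (follow (fun m => q (l - m)) l b)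
  (follow (fun m => q (l - m)) l (~~ b)) (follow (fun m => p (l - m)) l (~~ b)).
all: rewrite ?follow_last ?follow_le ?lj ?subnn ?p0 ?q0 //.
- by rewrite lN andbT ltnS.
- by rewrite ljl ltnSn.
- move=> k /andP[lk]; rewrite ltnS => kl' kl.
  have {}kl : k < l by rewrite ltn_neqAle kl.
  by rewrite !follow_le.
- by apply: nab; case: (b).
- by apply: nab; case: (b).
- move=> k /andP[jk]; rewrite ltnS leq_eqVlt => /orP[/eqP->|kl].
    by rewrite follow_last follow_le ?subnn ?p0.
  rewrite !follow_le ?(ltnW kl) //.
  have [] := Hpq (l - k.+1); first by clear -jk kl; lia.
  by rewrite /layer_pos_rev -!subSn // subSS subKn ?(ltnW kl) // subSS.
- move=> k /andP[jk]; rewrite ltnS leq_eqVlt => /orP[/eqP->|kl].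
    by rewrite follow_last follow_le ?subnn ?q0.
  rewrite !follow_le ?(ltnW kl) //.
  have [] := Hpq (l - k.+1); first by clear -jk kl; lia.
  by rewrite /layer_pos_rev -!subSn // subSS subKn ?(ltnW kl) // subSS.
exists s' => // k c kN; have := H k c kN.
by rewrite !follow_last !follow_le // subnn p0 q0 [_ + ((_, b) == c)]addnC.
Qed.

Definition nondet s k : bool :=
  [exists a, 0 < edge_count s k (a, a)] && [exists a, 0 < edge_count s k (a, ~~ a)].

Definition nondets s : nat := \sum_(0 <= k < N) nondet s k.

Lemma nondet_both_parities s k :
  both_parities (layer_pos s true) (layer_pos s false) k = nondet s k.
Proof.
by congr (_ && _); apply: eq_existsb => a; rewrite edge_count_layers addn_gt0.
Qed.

Lemma nondet_both_parities_rev s l m :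
  both_parities (layer_pos_rev s true l) (layer_pos_rev s false l) m = nondet s (l - m.+1).
Proof.
rewrite -nondet_both_parities; congr (_ && _).
by apply/existsP/existsP => -[a Ha]; exists (~~ a); rewrite /layer_pos_rev ?negbK in Ha *.
Qed.

(** Without the exchange there is no meeting on either side of [l]. This leaves at most one edge
    with both parities on the right, one on the left, and [l] itself. *)
Lemma cross_exchange s l a b : l < N -> 4 <= nondets s -> cross s l a b ->
  cross_exchangeable s l a b.
Proof.
move=> lN nd Q; apply: NNPP => nQ.
have [Tab Tab' Fab Fab'] := Q.
have nR (d : bool) : ~ meet N (layer_pos s true) (layer_pos s false) l.+1 d.
  move=> H; apply: nQ; have [E|E] := eqVneq d b.
    by subst d; exact: cross_exchange_right H.
  have Ed : d = ~~ b by move: E; case: (d) (b) => [] [].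
  subst d; apply/cross_exchangeable_flip/(cross_exchange_right _ (cross_flip Q)) => //.
have nL (d : bool) : ~ meet l (layer_pos_rev s true l) (layer_pos_rev s false l) 0 d.
  move=> H; apply: nQ; have [E|E] := eqVneq d a.
    by subst d; exact: cross_exchange_left H.
  have Ed : d = ~~ a by move: E; case: (d) (a) => [] [].
  subst d; apply/cross_exchangeable_flip/(cross_exchange_left _ (cross_flip Q)) => //.
have Rle : \sum_(l.+1 <= k < N) nondet s k <= 1.
  rewrite -(eq_bigr _ (fun k _ => congr1 nat_of_bool (nondet_both_parities s k))).
  apply: no_meet_both_parities nR => [m x y _|m x y _|m x y _|m x y _|x|x].
  - exact: layer_pos_next.
  - exact: layer_pos_next.
  - exact: layer_pos_prev.
  - exact: layer_pos_prev.
  - have [->|xb] := eqVneq x b; first exact: layer_pos_next Tab.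
    by have -> : x = ~~ b; [move: xb; case: (x) (b) => [] []|exact: layer_pos_next Tab'].
  - have [->|xb] := eqVneq x b; first exact: layer_pos_next Fab'.
    by have -> : x = ~~ b; [move: xb; case: (x) (b) => [] []|exact: layer_pos_next Fab].
have Lle : \sum_(0 <= k < l) nondet s k <= 1.
  (* In layer 0 all arcs of a group start at the same node, so no cross lies there. *)
  have l0 : 0 < l.
    case: (l) Tab Tab' => // /layer_posP[x _ [-> E _]] /layer_posP[y _ [+ E' _]].
    by rewrite E' -E => /eqP; case: (true).
  have El : l = l.-1.+1 by rewrite prednK.
  have prev g u v : layer_pos s g l u v -> exists d, layer_pos_rev s g l 0 u d.
    by rewrite {1}El => /layer_pos_prev[d Hd]; exists d; rewrite /layer_pos_rev subn1.
  rewrite big_nat_rev /= add0n.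
  rewrite -(eq_bigr _ (fun k _ => congr1 nat_of_bool (nondet_both_parities_rev s l k))).
  apply: no_meet_both_parities nL => [m x y ml|m x y ml|m x y ml|m x y ml|x|x].
  1-4: rewrite /layer_pos_rev; have -> : l - m.+1 = (l - m.+2).+1 by rewrite -subSn.
  - exact: layer_pos_prev.
  - exact: layer_pos_prev.
  - exact: layer_pos_next.
  - exact: layer_pos_next.
  - have [->|xa] := eqVneq x a; first exact: prev Tab.
    by have -> : x = ~~ a; [move: xa; case: (x) (a) => [] []|exact: prev Tab'].
  - have [->|xa] := eqVneq x a; first exact: prev Fab.
    by have -> : x = ~~ a; [move: xa; case: (x) (a) => [] []|exact: prev Fab'].
have : nondets s <= 3; last by rewrite leqNgt nd.
rewrite /nondets (@big_cat_nat _ _ _ l) //= ?(ltnW lN) // [\sum_(l <= _ < _) _]big_ltn //.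
by have := leq_b1 (nondet s l); move: Rle Lle; clear; lia.
Qed.

(** * Connectivity of tables with equal edge margins *)

Definition layer_dist s t : nat :=
  \sum_(i : 'I_N * (bool * bool))
    ((layer_count s false i.1 i.2 - layer_count t false i.1 i.2) +
     (layer_count t false i.1 i.2 - layer_count s false i.1 i.2)).

(** [layer_dist] is an l1-distance written with truncated subtraction. Each count that gains ([P])
    or loses ([M]) an arc moves by one towards [t], so nothing overshoots. *)
Lemma layer_dist_lt s s' t (P M : nat -> bool * bool -> nat) :
  (forall k c, k < N -> layer_count s' false k c + M k c = layer_count s false k c + P k c) ->
  (forall k c, k < N -> P k c + M k c <= 1) ->
  (forall k c, k < N -> 0 < P k c -> layer_count s false k c < layer_count t false k c) ->
  (forall k c, k < N -> 0 < M k c -> layer_count t false k c < layer_count s false k c) ->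
  (exists k c, k < N /\ 0 < P k c) ->
  layer_dist s' t < layer_dist s t.
Proof.
move=> E PM1 HP HM [k [c [kN Pk]]].
apply: (@ltn_sum_ex _ _ _ (Ordinal kN, c)) => [[v d]|] /=.
  have := E v d (ltn_ord v); have := PM1 v d (ltn_ord v).
  have := HP v d (ltn_ord v); have := HM v d (ltn_ord v); clear; lia.
have := E k c kN; have := PM1 k c kN; have := HP k c kN Pk; move: Pk; clear; lia.
Qed.

Lemma nondets_edge s t : (forall k c, k < N -> edge_count s k c = edge_count t k c) ->
  nondets s = nondets t.
Proof.
move=> E; rewrite /nondets !big_nat; apply: eq_bigr => k /andP[_ kN].
by congr nat_of_bool; congr (_ && _); apply: eq_existsb => a; rewrite E.
Qed.

Local Notation node_count s k a := (count (fun x => (bit x 0 == false) && (bit x k == a)) s).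

Lemma node_count_out s k (a : bool) :
  node_count s k a = layer_count s false k (a, false) + layer_count s false k (a, true).
Proof.
rewrite /layer_count; elim: s => //= x s ->; rewrite /cell !xpair_eqE.
by case: (bit x k.+1); case: (_ == a); case: (_ == false) => /=; clear; lia.
Qed.

Lemma node_count_in s k (a : bool) :
  node_count s k.+1 a = layer_count s false k (false, a) + layer_count s false k (true, a).
Proof.
rewrite /layer_count; elim: s => //= x s ->; rewrite /cell !xpair_eqE.
by case: (bit x k); case: (_ == a); case: (_ == false) => /=; clear; lia.
Qed.

Lemma node_count_sum s k (a : bool) :
  node_count s k a + node_count s k (~~ a) = count (fun x => bit x 0 == false) s.
Proof.
elim: s => //= x s <-.
by case: (bit x k); case: a; case: (_ == false) => /=; clear; lia.
Qed.

Lemma node_count_edge s : count (fun x => bit x 0 == false) s =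
  edge_count s 0 (false, false) + edge_count s 0 (false, true).
Proof.
rewrite /edge_count; elim: s => //= x s ->; rewrite /cell !xpair_eqE.
by case: (bit x 1); case: (_ == false) => /=; clear; lia.
Qed.

(** Used for the layers 0 and [N], where the rows of the group with value 0 all pass through the
    node [false]. *)
Lemma node_count0 s k (a : bool) : bit ^~ k =1 bit ^~ 0 ->
  node_count s k a = (~~ a) * count (fun x => bit x 0 == false) s.
Proof.
move=> Ek; elim: s => [|x s IH]; first by rewrite muln0.
rewrite /= IH Ek; case: a {IH} => /=; case: (bit x 0) => /=; clear; lia.
Qed.

(** Induction on the distance in the group with value 0. A conformal cycle of the difference gives
    an augmentation. Without one the node counts agree, and a remaining difference gives a cross. *)
Lemma edge_count_conn s t :
  (forall k c, k < N -> edge_count s k c = edge_count t k c) -> 4 <= nondets s -> conn s t.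
Proof.
have [r] := ubnP (layer_dist s t); elim: r s => // r IH s; rewrite ltnS => sr Est nd.
have next s' (P M : nat -> bool * bool -> nat) : conn s s' ->
    (forall k c, k < N -> layer_count s' false k c + M k c = layer_count s false k c + P k c) ->
    (forall k c, k < N -> P k c + M k c <= 1) ->
    (forall k c, k < N -> 0 < P k c -> layer_count s false k c < layer_count t false k c) ->
    (forall k c, k < N -> 0 < M k c -> layer_count t false k c < layer_count s false k c) ->
    (exists k c, k < N /\ 0 < P k c) -> conn s t.
  move=> ss' E PM HP HM ex; apply: (conn_trans ss').
  have Es' k c : k < N -> edge_count s' k c = edge_count s k c.
    by move=> kN; rewrite (conn_edge_count c kN ss').
  apply: IH; first exact: leq_trans (layer_dist_lt E PM HP HM ex) sr.
    by move=> k c kN; rewrite Es' // Est.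
  by rewrite (nondets_edge Es').
(* The edge margins agree, so what [s] lacks in one group it has in excess in the other. *)
have Tlt k c : k < N -> layer_count s false k c < layer_count t false k c ->
    0 < layer_count s true k c.
  by move=> kN; have := Est k c kN; rewrite !edge_count_layers; clear; lia.
have Total : count (fun x => bit x 0 == false) s = count (fun x => bit x 0 == false) t.
  by rewrite !node_count_edge !Est.
pose D k a b : int := ((layer_count t false k (a, b))%:Z - (layer_count s false k (a, b))%:Z)%R.
pose V k a : int := ((node_count t k a)%:Z - (node_count s k a)%:Z)%R.
have [| | | | |[i [j [p [q [ij pqi pqj Dpq]]]]]|V0] := @circulation_cases N D V.
- by move=> k a _; rewrite /V /D !node_count_out; clear; lia.
- by move=> k a _; rewrite /V /D !node_count_in; clear; lia.
- by move=> k a _; have := node_count_sum s k a; have := node_count_sum t k a;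
    rewrite /V Total; clear; lia.
- by move=> a; rewrite /V !node_count0 // Total subrr.
- by move=> a; rewrite /V !(@node_count0 _ N) ?Total ?subrr // => x; rewrite bitN.
- have ijN k : i <= k < j -> k < N by move=> H; clear -H ij; lia.
  have Dp k : i <= k < j -> layer_count s false k (step p k) < layer_count t false k (step p k).
    by move=> /Dpq[+ _]; rewrite /D; clear; lia.
  have Dq k : i <= k < j -> layer_count t false k (step q k) < layer_count s false k (step q k).
    by move=> /Dpq[_]; rewrite /D; clear; lia.
  have [|k ijk|s' ss' E] := @augment s i j p q ij pqi pqj.
  + by move=> k ijk; apply: Tlt; [exact: ijN | exact: Dp].
  + exact: leq_ltn_trans (Dq k ijk).
  apply: (next s' _ _ ss' E).
  + move=> k c kN; rewrite /on_path; case: (boolP (i <= k < j)) => //= ijk.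
    case: eqP => [<-|_]; last by case: eqP.
    by case: eqP => // Eqp; have := Dp k ijk; have := Dq k ijk; rewrite Eqp; clear; lia.
  + by move=> k c kN; rewrite /on_path lt0b => /andP[ijk /eqP<-]; exact: Dp.
  + by move=> k c kN; rewrite /on_path lt0b => /andP[ijk /eqP<-]; exact: Dq.
  have iij : i <= i < j by clear -ij; lia.
  by exists i, (step p i); split; [exact: ijN | rewrite /on_path iij eqxx].
have [[k [a [b [kN Dab]]]]|noD] := classic (exists k a b, k < N /\
    layer_count s false k (a, b) < layer_count t false k (a, b)); last first.
  (* No count of [s] falls short, and the counts out of each node have equal sums, so all of them
     agree. *)
  have le k a b : k < N -> layer_count t false k (a, b) <= layer_count s false k (a, b).
    by move=> kN; rewrite leqNgt; apply/negP => H; apply: noD; exists k, a, b.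
  apply: layer_count_conn => g k [a b] kN.
  have Ef : layer_count s false k (a, b) = layer_count t false k (a, b).
    have := le k a b kN; have := le k a (~~ b) kN; have := V0 k a (ltnW kN).
    by rewrite /V !node_count_out; case: (b) => /=; clear; lia.
  case: g => //; have := Est k (a, b) kN; rewrite !edge_count_layers Ef; clear; lia.
have Va := V0 k a (ltnW kN); have Va' := V0 k (~~ a) (ltnW kN); have Vb := V0 k.+1 b kN.
(* Equal node counts on both sides of the layer make the row and column sums of the 2x2 difference
   vanish, so its signs alternate. *)
have [D1 D2 D3] : [/\ layer_count t false k (a, ~~ b) < layer_count s false k (a, ~~ b),
    layer_count t false k (~~ a, b) < layer_count s false k (~~ a, b) &
    layer_count s false k (~~ a, ~~ b) < layer_count t false k (~~ a, ~~ b)].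
  move: Va Va' Vb Dab; rewrite /V !node_count_in !node_count_out.
  by case: (a); case: (b) => /=; clear => Va Va' Vb Dab; split; lia.
have [|s' ss' E] := @cross_exchange s k a b kN nd.
  split; [exact: Tlt | exact: Tlt | exact: leq_ltn_trans D1 | exact: leq_ltn_trans D2].
have nab (x y : bool) : (~~ x == y) = ~~ (x == y) by case: x; case: y.
apply: (next s' _ _ ss' E).
- move=> m [c d] _; rewrite !xpair_eqE !nab; case: (m == k) => //=.
  by case: (a == c); case: (b == d).
- move=> m c mN; case: (m =P k) => [->|//]; rewrite mul1n addn_gt0 !lt0b.
  by case/orP=> /eqP<-.
- move=> m c mN; case: (m =P k) => [->|//]; rewrite mul1n addn_gt0 !lt0b.
  by case/orP=> /eqP<-.
by exists k, (a, b); rewrite !eqxx.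
Qed.

End Rows.
Lemma sum_count_mem (T : finType) (P : pred T) (s : seq T) :
  \sum_(x | P x) count_mem x s = count P s.
Proof.
elim: s => [|y s IH] /=; first by rewrite big1.
rewrite big_split /= IH; congr (_ + _).
rewrite big_mkcond (bigD1 y) //= eqxx big1 ?addn0; first by case: (P y).
by move=> x; rewrite eq_sym => /negbTE->; case: ifP.
Qed.

(** * Swaps as global Markov moves, and edge margins *)

Section CycleMoves.

Variable n : nat.
Local Notation N := n.+1.
Local Notation row := (state (binary N)).
Implicit Types (x y : row) (s t : seq row) (A B C : {set 'I_N}).

Lemma separates_neighbours A B C (a b : 'I_N) :
  separated_partition (cycle_graph N) A B C -> a \in A -> b \in B -> ~~ cycle_graph N a b.
Proof.
case=> _ AC BC _ sep aA bB; apply/negP => ab.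
have := sep a [:: b] aA; rewrite /= ab orbF => /(_ isT bB)/orP[aC|bC].
  by rewrite (disjointFr AC aA) in aC.
by rewrite (disjointFr BC bB) in bC.
Qed.

(** A path leaving [A] cannot step directly into [B], so it enters [C] first. *)
Lemma separatedI A B C :
  [disjoint A & B] -> [disjoint A & C] -> [disjoint B & C] -> A :|: B :|: C = [set: 'I_N] ->
  (forall a b, a \in A -> b \in B -> ~~ cycle_graph N a b) ->
  separated_partition (cycle_graph N) A B C.
Proof.
move=> AB AC BC cov nAB; split=> // a p; elim: p a => [|b p IH] a aA /=.
  by move=> _ aB; rewrite (disjointFr AB aA) in aB.
case/andP=> ab pb pB; have : b \in A :|: B :|: C by rewrite cov inE.
rewrite !inE => /orP[/orP[bA|bB]|bC].
- by apply/orP; right; exact: IH b bA pb pB.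
- by have := nAB a b aA bB; rewrite ab.
- by apply/orP; right; apply/orP; left.
Qed.

Lemma swap_arc_glue i j x y : i < j <= N -> bit x i = bit y i -> bit x j = bit y j ->
  exists A B C, [/\ separated_partition (cycle_graph N) A B C,
    glue A B x x x = x, glue A B y y x = y,
    glue A B y x x = swap_arc i j x y & glue A B x y x = swap_arc i j y x].
Proof.
move=> /andP[ij jN] xyi xyj; have iN : i < N := leq_trans ij jN.
pose A := [set v : 'I_N | i < v < j].
(* [j] may be [N], which is vertex 0. If moreover [i = 0], the separator is a single vertex. *)
pose C := [set v : 'I_N | (v == i :> nat) || (v == j %% N :> nat)].
pose B := ~: (A :|: C).
have xyC v : v \in C -> x v = y v.
  by rewrite inE => /orP[]/eqP Ev; apply/bit_eq; rewrite Ev // !bit_mod.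
have AC v : v \in A -> v \notin C.
  rewrite !inE => /andP[iv vj]; rewrite negb_or neq_ltn iv orbT /=.
  move: jN; rewrite leq_eqVlt => /orP[/eqP->|jN'].
    by rewrite modnn -lt0n (leq_ltn_trans _ iv).
  by rewrite modn_small // neq_ltn vj.
exists A, B, C; split.
- apply: separatedI.
  + by rewrite disjoints_subset setCK subsetUl.
  + by rewrite disjoints_subset; apply/subsetP => v vA; rewrite in_setC AC.
  + by rewrite disjoint_sym disjoints_subset setCK subsetUr.
  + by rewrite -setUA [B :|: C]setUC setUA setUCr.
  move=> a b; rewrite !inE !negb_or => /andP[ia aj] /and3P[nA bi bj].
  apply/andP; split; apply/eqP => /(congr1 val) /= E.
    move: (ltn_ord a); rewrite leq_eqVlt => /orP[/eqP aN|aN].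
      have jN' : j = N by clear -aN aj jN; lia.
      by move: bj; rewrite E aN jN' modnn.
    move: E nA bj; rewrite modn_small // => ->; rewrite ltnS (ltnW ia) /= -leqNgt => ja.
    have <- : a.+1 = j by apply/eqP; rewrite eqn_leq ja aj.
    by rewrite modn_small ?eqxx.
  move: (ltn_ord b); rewrite leq_eqVlt => /orP[/eqP bN|bN].
    by move: ia; rewrite E bN modnn.
  by move: ia aj nA bi; rewrite E modn_small //; clear; lia.
- by apply/ffunP => v; rewrite ffunE; do !case: ifP.
- apply/ffunP => v; rewrite ffunE; case: ifP => // vA; case: ifP => // vB.
  by apply: xyC; move: vA vB; rewrite !inE => -> /negbFE.
- by apply/ffunP => v; rewrite ffunE swap_arcE inE; case: ifP => // _; case: ifP.
- apply/ffunP => v; rewrite ffunE swap_arcE; case: ifP => [|vA]; first by rewrite inE => ->.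
  have := vA; rewrite inE => ->; case: ifP => // vB.
  by apply: xyC; move: vA vB; rewrite !inE => -> /negbFE.
Qed.

Definition row_counts s : {ffun row -> nat} := [ffun x => count_mem x s].

Lemma row_counts_surj (u : {ffun row -> nat}) : exists s, row_counts s = u.
Proof.
exists (flatten [seq nseq (u x) x | x <- enum row]); apply/ffunP => x.
rewrite ffunE count_flatten -map_comp sumnE big_map big_enum /=.
rewrite (bigD1 x) //= count_nseq /= eqxx mul1n big1 ?addn0 // => y yx.
by rewrite /= count_nseq /= (negbTE yx).
Qed.

Lemma conn_move_step s t : conn s t ->
  clos_refl_trans _ (@move_step N (cycle_graph N) (binary N)) (row_counts s) (row_counts t).
Proof.
elim=> {s t} [s t /permP st|i j x y s ij xyi xyj|s t r _ st _ tr].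
- have -> : row_counts s = row_counts t by apply/ffunP => x; rewrite !ffunE st.
  exact: rt_refl.
- have [A [B [C [sep Ex Ey Exy Eyx]]]] := swap_arc_glue ij xyi xyj.
  apply: rt_step; exists (unit_vec x + unit_vec y - unit_vec (swap_arc i j y x)
      - unit_vec (swap_arc i j x y))%R.
    by exists A, B, C, x, y, x, y, x; rewrite Ex Ey Exy Eyx.
  (* The move has [x] and [y] with positive sign, whereas the step removes them. *)
  right; apply/ffunP => z; rewrite !ffunE /= !(eq_sym z).
  by do 4!case: eqP => _ /=; clear; lia.
- exact: rt_trans st tr.
Qed.

Lemma margin_row_counts s (W : {set 'I_N}) y :
  margin (row_counts s) W y = count (fun x => agree W x y) s.
Proof. by rewrite /margin -sum_count_mem; apply: eq_bigr => x _; rewrite ffunE. Qed.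

Definition edge_set k : {set 'I_N} := [set inZp k; inZp k.+1].

Lemma edge_clique k : clique (cycle_graph N) (edge_set k).
Proof.
have E : ordS (inZp k : 'I_N) = inZp k.+1.
  by apply: val_inj; rewrite /= -addn1 modnDml addn1.
apply/forall_inP => i iW; apply/forall_inP => j jW; apply/implyP; move: iW jW.
by rewrite !inE /cycle_graph /= => /orP[]/eqP-> /orP[]/eqP->; rewrite ?E ?eqxx ?orbT.
Qed.

Lemma agree_edge k x y : agree (edge_set k) x y = (cell x k == cell y k).
Proof.
have E m : bit x m = bit y m <-> x (inZp m) = y (inZp m).
  by rewrite -(bit_eq x y) /= !bit_mod.
apply/forall_inP/eqP => [H|[/E Ek /E Ek1] v].
  by congr (_, _); apply/E/eqP/H; rewrite !inE eqxx ?orbT.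
by rewrite !inE => /orP[]/eqP->; apply/eqP.
Qed.

Lemma cell_surj k (c : bool * bool) : 1 < N -> exists y, cell y k = c.
Proof.
move=> N1; exists [ffun v => if v == inZp k then inZp c.1 else inZp c.2].
have nk : (inZp k.+1 == inZp k :> 'I_N) = false.
  apply/negbTE/eqP => /(congr1 val)/= /eqP; rewrite -[X in _ == X %% _]addn0 -addn1.
  by rewrite eqn_modDl mod0n modn_small.
rewrite /cell /bit !ffunE eqxx nk /=; case: c => [] [] [] //.
Qed.

Lemma edge_count_margin s k c : 1 < N -> exists y, forall t,
  edge_count t k c = margin (row_counts t) (edge_set k) y.
Proof.
move=> N1; have [y <-] := cell_surj k c N1; exists y => t.
by rewrite margin_row_counts; apply: eq_count => x; rewrite agree_edge.
Qed.

(** Positive edge margins provide both parities on every edge, hence [N] edges of this kind, and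
    four suffice. *)
Lemma cycle_positive_margins : 4 <= N ->
  positive_margins_property (cycle_graph N) (binary N).
Proof.
move=> N4 u upos v w; have N1 : 1 < N by apply: leq_trans N4.
have [r Er] := row_counts_surj u; subst u.
have [s <-] := row_counts_surj v; have [t <-] := row_counts_surj w => rs rt.
have Ers k c : edge_count s k c = edge_count r k c.
  by have [y E] := edge_count_margin s k c N1; rewrite !E rs ?edge_clique.
have Ert k c : edge_count t k c = edge_count r k c.
  by have [y E] := edge_count_margin s k c N1; rewrite !E rt ?edge_clique.
apply/conn_move_step/edge_count_conn => [k c _|]; first by rewrite Ers Ert.
rewrite /nondets big_nat (eq_bigr (fun=> 1)) ?sum1_size.
  by rewrite -big_nat sum_nat_const_nat subn0 muln1.
move=> k _; have pos c : 0 < edge_count s k c.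
  by rewrite Ers; have [y ->] := edge_count_margin s k c N1; rewrite upos ?edge_clique.
by rewrite /nondet; do 2!(case: existsP => [_|[]]; last by exists true).
Qed.

End CycleMoves.

(** * Counting the changes of a bit sequence *)

Section Changes.

Variable delta : nat -> bool.

Lemma change_between u w : u <= w -> delta u != delta w ->
  1 <= \sum_(u <= k < w) (delta k != delta k.+1).
Proof.
elim: w => [|w IH]; first by rewrite leqn0 => /eqP->; rewrite eqxx.
rewrite leq_eqVlt => /orP[/eqP->|]; first by rewrite eqxx.
rewrite ltnS => uw uw1; rewrite big_nat_recr //=.
case: (eqVneq (delta u) (delta w)) => [E|/(IH uw)]; last by clear; lia.
by rewrite -E uw1 addn1.
Qed.

(** [Y] is handed on as long as [delta] holds, so it can only be lost where [delta] fails. It will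
    be membership in one side of a separated partition. *)
Lemma gap_before (Y : nat -> bool) u w : u <= w -> Y u ->
  (forall k, delta k -> delta k.+1 -> Y k -> Y k.+1) -> ~~ Y w ->
  exists2 v, u <= v <= w & ~~ delta v.
Proof.
move=> uw Yu step; elim: w uw => [|w IH].
  by rewrite leqn0 => /eqP<-; rewrite Yu.
rewrite leq_eqVlt => /orP[/eqP<-|]; first by rewrite Yu.
rewrite ltnS => uw nY.
case: (boolP (delta w.+1)) => [dw1|]; last by exists w.+1; rewrite // leqW // leqnn.
case: (boolP (delta w)) => [dw|]; last by exists w; rewrite // uw leqnSn.
case: (boolP (Y w)) => [/(step _ dw dw1)|/(IH uw)[v /andP[uv vw] dv]].
  by rewrite (negbTE nY).
by exists v; rewrite // uv leqW.
Qed.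

Lemma changes_around u v w : u <= v <= w -> delta u -> ~~ delta v -> delta w ->
  2 <= \sum_(u <= k < w) (delta k != delta k.+1).
Proof.
move=> /andP[uv vw] du dv dw; rewrite (big_cat_nat uv vw) /=.
have := change_between uv; have := change_between vw.
by rewrite du dw (negbTE dv) => /(_ isT) + /(_ isT); clear; lia.
Qed.

End Changes.

Lemma sum_periodic (f : nat -> nat) m u : (forall k, f (k + m) = f k) ->
  \sum_(u <= k < u + m) f k = \sum_(0 <= k < m) f k.
Proof.
move=> per; elim: u => [|u <-] //; rewrite addSn.
have := @big_nat_recr _ 0 addn (u + m) u f (leq_addr m u).
rewrite big_ltn ?ltnS ?leq_addr //= per => E.
by apply: (@addnI (f u)); rewrite E addnC.
Qed.

(** * Ideals given by generators *)

Section Ideals.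

Local Open Scope ring_scope.

Variables (R : comNzRingType) (S : R -> Prop).

Lemma generated_ideal0 : generated_ideal S 0.
Proof. by exists [::]; rewrite ?big_nil. Qed.

Lemma generated_idealD f g :
  generated_ideal S f -> generated_ideal S g -> generated_ideal S (f + g).
Proof.
case=> s Ss -> [t St ->]; exists (s ++ t); rewrite ?big_cat // => p.
by rewrite mem_cat => /orP[/Ss|/St].
Qed.

Lemma generated_idealM h f : generated_ideal S f -> generated_ideal S (h * f).
Proof.
case=> s Ss ->; exists [seq (h * p.1, p.2) | p <- s].
  by move=> _ /mapP[p /Ss Sp ->].
by rewrite big_map big_distrr; apply: eq_bigr => p _; rewrite /= mulrA.
Qed.

Lemma generated_ideal_gen f : S f -> generated_ideal S f.
Proof.
by move=> Sf; exists [:: (1, f)]; [move=> p; rewrite inE => /eqP->|rewrite big_seq1 mul1r].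
Qed.

Lemma generated_ideal_ker (R' : pzRingType) (h : {rmorphism R -> R'}) f :
  (forall g, S g -> h g = 0) -> generated_ideal S f -> h f = 0.
Proof.
move=> hS [s Ss ->]; rewrite rmorph_sum big_seq big1 // => p ps.
by rewrite rmorphM (hS _ (Ss p ps)) mulr0.
Qed.

End Ideals.

(** * Scaling the variables of a polynomial ring *)

Section ScaleVariables.

Local Open Scope ring_scope.

Variables (r : nat) (k : fieldType) (c : 'I_r -> k).

(** With coefficients 0 and 1 this kills some variables and fixes the others. *)
Definition scale_vars : {mpoly k[r]} -> {mpoly k[r]} :=
  mmap (@mpolyC r k) (fun i => c i *: 'X_i).

HB.instance Definition _ := GRing.RMorphism.on scale_vars.

Lemma mcoeff_scale_vars f m : (scale_vars f)@_m = f@_m * \prod_i c i ^+ m i.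
Proof.
rewrite /scale_vars /mmap (raddf_sum (mcoeff m)).
have E m' : (f@_m')%:MP * mmap1 (fun i => c i *: 'X_i) m' =
    (f@_m' * \prod_i c i ^+ m' i) *: 'X_[m'] :> {mpoly k[r]}.
  rewrite mul_mpolyC /mmap1 mpolyXE_id -scalerA; congr (_ *: _).
  rewrite -mul_mpolyC rmorph_prod -big_split; apply: eq_bigr => i _ /=.
  by rewrite exprZn mul_mpolyC.
rewrite (eq_bigr _ (fun m' _ => congr1 (mcoeff m) (E m'))).
under eq_bigr do rewrite mcoeffZ mcoeffX.
case: (boolP (m \in msupp f)) => mf.
  rewrite (bigD1_seq m) ?msupp_uniq //= eqxx mulr1 [X in _ + X]big1 ?addr0 //.
  by move=> m' /negbTE->; rewrite mulr0.
rewrite memN_msupp_eq0 // mul0r big_seq [LHS]big1 // => m' m'f.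
by case: eqP => [Em|_]; [rewrite Em (negbTE mf) in m'f | rewrite mulr0].
Qed.

End ScaleVariables.

(** * Radicality of the global Markov ideal of the cycle *)

Section CycleIdeal.

Variables (n : nat) (k : fieldType).
Local Notation N := n.+1.
Local Notation row := (state (binary N)).
Local Notation poly_ring := {mpoly k[#|{: row}|]}.
Implicit Types (x y : row) (s t : seq row) (A B C : {set 'I_N}).

Definition parity x j : bool := (cell x j).1 (+) (cell x j).2.

(** These [x] index the variables that are kept for the table [s]. For different edges, the parity
    of [x] may be found in different rows of [s]. *)
Definition compatible s x : bool :=
  [forall v : 'I_N, has (fun y => parity y v == parity x v) s].

Lemma inZpD j : inZp (j + N) = inZp j :> 'I_N.
Proof. by apply: val_inj; rewrite /= modnDr. Qed.

Lemma cycle_graph_succ j : cycle_graph N (inZp j) (inZp j.+1).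
Proof.
rewrite /cycle_graph /=; apply/orP; left; apply/eqP; apply: val_inj.
by rewrite /= -[in RHS]addn1 modnDml addn1.
Qed.

Lemma compatible_nondet s x y j : j < N -> compatible s x -> compatible s y ->
  parity x j != parity y j -> nondet s j.
Proof.
move=> jN /forallP/(_ (Ordinal jN))/hasP[u us /= /eqP ux].
move=> /forallP/(_ (Ordinal jN))/hasP[w ws /= /eqP wy]; rewrite -ux -wy => uw.
have pos z b : z \in s -> parity z j = b ->
    [exists a, 0 < edge_count s j (a, if b then ~~ a else a)].
  move=> zs <-; apply/existsP; exists (bit z j); rewrite /edge_count -has_count.
  apply/hasP; exists z => //; rewrite /parity /cell /=.
  by case: (bit z j); case: (bit z j.+1).
rewrite /nondet; case Eu: (parity u j) uw => uw.
  have Ew : parity w j = false by move: uw; case: (parity w j).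
  by rewrite (pos u true us Eu) (pos w false ws Ew).
have Ew : parity w j = true by move: uw; case: (parity w j).
by rewrite (pos u false us Eu) (pos w true ws Ew).
Qed.

Section Glue.

Variables (A B C : {set 'I_N}) (xA xA' xB xB' xC : row).
Hypothesis sep : separated_partition (cycle_graph N) A B C.

Let a := glue A B xA xB xC.
Let b := glue A B xA' xB' xC.
Let c := glue A B xA xB' xC.
Let d := glue A B xA' xB xC.

Lemma not_adjacent j : inZp j \in A -> inZp j.+1 \notin B.
Proof.
by move=> jA; apply/negP => /(separates_neighbours sep jA); rewrite cycle_graph_succ.
Qed.

Lemma not_adjacent' j : inZp j \in B -> inZp j.+1 \notin A.
Proof.
move=> jB; apply/negP => jA; have := separates_neighbours sep jA jB.
by rewrite cycle_graph_sym cycle_graph_succ.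
Qed.

(** No edge joins [A] and [B], so each edge avoids one of them. On it the two pairs of rows differ
    at most in which row holds which cell. *)
Lemma glue_cell j : (cell c j = cell a j /\ cell d j = cell b j) \/
  (cell c j = cell b j /\ cell d j = cell a j).
Proof.
have := @not_adjacent j; have := @not_adjacent' j.
rewrite /cell /bit /a /b /c /d !ffunE.
case: (inZp j \in A); case: (inZp j \in B); case: (inZp j.+1 \in A); case: (inZp j.+1 \in B);
  move=> H1 H2; by [left | right | have := H1 isT | have := H2 isT].
Qed.

Lemma glue_compatible s :
  (compatible s c && compatible s d) = (compatible s a && compatible s b).
Proof.
apply/andP/andP => -[/forallP H1 /forallP H2]; split; apply/forallP => v;
  have := H1 v; have := H2 v; rewrite /parity;
  by case: (glue_cell v) => -[E1 E2]; rewrite ?E1 ?E2.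
Qed.

Let delta j := bit a j (+) bit b j.

Lemma delta_AB j : delta j -> (inZp j \in A) || (inZp j \in B).
Proof.
rewrite /delta /bit /a /b !ffunE.
by case: (_ \in A); case: (_ \in B) => //; rewrite addbb.
Qed.

Lemma deltaD j : delta (j + N) = delta j.
Proof. by rewrite /delta /bit inZpD. Qed.

Lemma delta_neq (v : 'I_N) : a v != b v -> delta v.
Proof.
by move=> ab; rewrite /delta; apply/negPn; rewrite -negb_eqb negbK; apply: contraNN ab
  => /eqP/bit_eq->.
Qed.

(** Suppose [a] and [b] differ at a vertex of [A] and at a vertex of [B]. They agree on [C] and no
    edge joins [A] to [B], so on both ways round the cycle between these vertices there is a place
    where they agree. Hence [delta] changes at least four times, and each change is an edge on which
    the parities of [a] and [b] differ, so that both occur in [s]. *)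
Lemma glue_trivial s : nondets s <= 3 -> compatible s a -> compatible s b ->
  (c = a /\ d = b) \/ (c = b /\ d = a).
Proof.
move=> nd Sa Sb.
have [/exists_inP[alpha aA ab_a]|nA] := boolP [exists v in A, a v != b v]; last first.
  right; suff E v : v \in A -> xA v = xA' v.
    by split; apply/ffunP => v; rewrite !ffunE; case: ifP => // /E.
  move=> vA; move/exists_inPn: nA => /(_ v vA)/negPn/eqP.
  by rewrite !ffunE vA.
have [/exists_inP[beta bB ab_b]|nB] := boolP [exists v in B, a v != b v]; last first.
  left; suff E v : v \in B -> xB v = xB' v.
    by split; apply/ffunP => v; rewrite !ffunE; case: ifP => // _; case: ifP => // /E.
  move=> vB; move/exists_inPn: nB => /(_ v vB)/negPn/eqP.
  by case: sep => AB _ _ _ _; rewrite !ffunE vB (disjointFl AB vB).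
exfalso; have [AB _ _ _ _] := sep.
(* The position of [beta] is lifted past [alpha], so that the way from [alpha] through [be] to
   [alpha + N] is one turn of the cycle. *)
pose be := if alpha < beta then beta : nat else beta + N.
have beB : inZp be = beta :> 'I_N by rewrite /be; case: ifP; rewrite ?inZpD valZpK.
have dbe : delta be.
  by rewrite /be; case: ifP; rewrite ?deltaD delta_neq.
have alN : inZp (alpha + N) = alpha :> 'I_N by rewrite inZpD valZpK.
have [albe beal] : alpha <= be /\ be <= alpha + N.
  rewrite /be; have := ltn_ord alpha; have := ltn_ord beta.
  by case: (ltnP alpha beta); clear => *; split; lia.
have [v1 v1I d1] : exists2 v, alpha <= v <= be & ~~ delta v.
  apply: (@gap_before _ (fun j => inZp j \in A) alpha be albe).
  - by rewrite valZpK.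
  - move=> j _ dj1 jA; have := delta_AB dj1.
    by rewrite (negbTE (not_adjacent jA)) orbF.
  - by rewrite beB (disjointFl AB bB).
have [v2 v2I d2] : exists2 v, be <= v <= alpha + N & ~~ delta v.
  apply: (@gap_before _ (fun j => inZp j \in B) be (alpha + N) beal).
  - by rewrite beB.
  - move=> j _ dj1 jB; have := delta_AB dj1.
    by rewrite (negbTE (not_adjacent' jB)).
  - by rewrite alN (disjointFr AB aA).
have dal := delta_neq ab_a.
have := changes_around v1I dal d1 dbe.
have := changes_around v2I dbe d2; rewrite deltaD => /(_ dal).
have : \sum_(alpha <= j < alpha + N) (delta j != delta j.+1) <= 3.
  rewrite (@sum_periodic (fun j => delta j != delta j.+1)) => [|j]; last first.
    by rewrite -addSn !deltaD.
  apply: leq_trans nd; rewrite /nondets !big_nat; apply: leq_sum => j /andP[_ jN].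
  case: eqP => //= H; rewrite lt0b; apply: (compatible_nondet jN Sa Sb).
  apply/eqP => E; apply: H; move: E; rewrite /parity /delta /cell /=.
  by case: (bit a j); case: (bit b j); case: (bit a j.+1); case: (bit b j.+1).
by rewrite (big_cat_nat albe beal) /=; clear; lia.
Qed.

End Glue.

Local Open Scope ring_scope.

Local Notation ideal := (global_ideal (cycle_graph N) (binary N) k).

(** Either both products are killed together, or all four variables survive and the binomial is
    already zero. *)
Lemma compatible_scale_kills s (g : poly_ring) : (nondets s <= 3)%N ->
  global_binomial (cycle_graph N) g ->
  scale_vars (fun i => (compatible s (enum_val i))%:R) g = 0.
Proof.
move=> nd [A [B [C [xA [xA' [xB [xB' [xC [sep ->]]]]]]]]].
have E x : scale_vars (fun i => (compatible s (enum_val i))%:R) (pvar k x) =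
    (compatible s x)%:R *: pvar k x.
  by rewrite /scale_vars /pvar mmapX mmap1U enum_rankK.
rewrite rmorphB !rmorphM /= !E -!scalerAl -!scalerAr !scalerA -!natrM !mulnb.
rewrite (glue_compatible _ _ _ _ _ sep).
case: (boolP (_ && _)) => [/andP[Sa Sb]|_]; last by rewrite !scale0r subrr.
case: (glue_trivial sep nd Sa Sb) => -[-> ->]; first by rewrite subrr.
by rewrite mulrC subrr.
Qed.

Definition rows_monomial s : poly_ring := \prod_(x <- s) pvar k x.

Lemma conn_ideal s t : conn s t -> ideal (rows_monomial s - rows_monomial t).
Proof.
elim=> {s t} [s t st|i j x y s ij xyi xyj|s t r _ st _ tr].
- by rewrite /rows_monomial (perm_big _ st) subrr; exact: generated_ideal0.
- have [A [B [C [sep Ex Ey Exy Eyx]]]] := swap_arc_glue ij xyi xyj.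
  rewrite /rows_monomial !big_cons !mulrA -mulrBl mulrC.
  apply/generated_idealM/generated_ideal_gen; exists A, B, C, x, y, x, y, x.
  by rewrite Ex Ey Exy Eyx [X in _ = _ - X]mulrC.
- have -> : rows_monomial s - rows_monomial r =
      (rows_monomial s - rows_monomial t) + (rows_monomial t - rows_monomial r).
    by rewrite addrA subrK.
  exact: generated_idealD.
Qed.

Definition monomial_rows (m : 'X_{1..#|{: row}|}) : seq row :=
  flatten [seq nseq (m (enum_rank x)) x | x <- enum {: row}].

Lemma monomial_rowsE m : 'X_[m] = rows_monomial (monomial_rows m).
Proof.
rewrite /rows_monomial /monomial_rows big_flatten big_map big_enum /= mpolyXE_id.
rewrite (reindex_onto enum_rank enum_val) => [|i _]; last exact: enum_valK.
apply: eq_big => [x|x _]; first by rewrite enum_rankK eqxx.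
by rewrite big_nseq -Monoid.iteropE.
Qed.

Lemma mem_monomial_rows m x : (x \in monomial_rows m) = (0 < m (enum_rank x))%N.
Proof.
apply/flatten_mapP/idP => [[y _]|mx]; first by rewrite mem_nseq => /andP[? /eqP->].
by exists x; rewrite ?mem_enum // mem_nseq mx eqxx.
Qed.

Lemma compatible_mem s x : x \in s -> compatible s x.
Proof. by move=> xs; apply/forallP => v; apply/hasP; exists x. Qed.

(** In an integral domain the image of [f] vanishes with that of [f ^+ j]. Killing the variables
    incompatible with the rows of [m] keeps the coefficient at [m], so with at most three such edges
    [m] could not occur in [f]. *)
Lemma monomial_nondets (f : poly_ring) j m : (0 < j)%N -> ideal (f ^+ j) ->
  m \in msupp f -> (4 <= nondets (monomial_rows m))%N.
Proof.
move=> j0 If mf; rewrite ltnNge; apply/negP => nd.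
have := generated_ideal_ker (fun g => compatible_scale_kills nd) If.
rewrite rmorphXn /= => /eqP; rewrite expf_eq0 j0 /= => /eqP/(congr1 (mcoeff m)).
rewrite mcoeff_scale_vars mcoeff0 big1 ?mulr1 => [|i _].
  by move/eqP; rewrite mcoeff_eq0 mf.
case: (posnP (m i)) => [->|mi]; first by rewrite expr0.
by rewrite compatible_mem ?expr1n // mem_monomial_rows enum_valK.
Qed.

Local Notation edge_index := ('I_N * (bool * bool))%type.

(** There is one parameter for each edge and each pair of values at its ends, so that the exponents
    in the toric image of a monomial are its edge margins. *)
Definition edge_mnm x : 'X_{1..#|{: edge_index}|} :=
  (\sum_(v : 'I_N) U_(enum_rank (v, cell x v)))%MM.

Definition toric : poly_ring -> {mpoly k[#|{: edge_index}|]} :=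
  mmap (@mpolyC _ k) (fun i => 'X_[edge_mnm (enum_val i)]).

HB.instance Definition _ := GRing.RMorphism.on toric.

Lemma toric_pvar x : toric (pvar k x) = 'X_[edge_mnm x].
Proof. by rewrite /toric /pvar mmapX mmap1U enum_rankK. Qed.

Lemma toric_kills (g : poly_ring) : global_binomial (cycle_graph N) g -> toric g = 0.
Proof.
move=> [A [B [C [xA [xA' [xB [xB' [xC [sep ->]]]]]]]]].
rewrite rmorphB !rmorphM /= !toric_pvar -!mpolyXD /edge_mnm -!big_split /=.
apply/eqP; rewrite subr_eq0; apply/eqP; congr 'X_[_]; apply: eq_bigr => v _.
by case: (glue_cell xA xA' xB xB' xC sep v) => -[-> ->] //; rewrite addmC.
Qed.

Definition rows_mnm s := (\sum_(x <- s) edge_mnm x)%MM.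

Lemma rows_mnmE s (v : 'I_N) c : rows_mnm s (enum_rank (v, c)) = edge_count s v c.
Proof.
rewrite mnm_sumE /edge_count -sum1_count [RHS]big_mkcond; apply: eq_bigr => x _.
rewrite mnm_sumE (bigD1 v) //= mnm1E big1 => [|w wv].
  by rewrite addn0 (inj_eq enum_rank_inj) xpair_eqE eqxx; case: ifP.
by rewrite mnm1E (inj_eq enum_rank_inj) xpair_eqE (negbTE wv).
Qed.

Lemma toric_monomial m : toric 'X_[m] = 'X_[rows_mnm (monomial_rows m)].
Proof.
rewrite monomial_rowsE rmorph_prod /= (eq_bigr _ (fun x _ => toric_pvar x)).
by rewrite /rows_mnm; elim/big_ind2: _ => [|p q p' q' -> ->|//]; rewrite ?mpolyX0 ?mpolyXD.
Qed.

Lemma mcoeff_toric (f : poly_ring) e : (toric f)@_e =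
  \sum_(m <- msupp f | rows_mnm (monomial_rows m) == e) f@_m.
Proof.
rewrite [in LHS](mpolyE f) rmorph_sum (raddf_sum (mcoeff e)) [RHS]big_mkcond.
apply: eq_bigr => m _; rewrite -mul_mpolyC rmorphM /= {1}/toric mmapC toric_monomial.
by rewrite mcoeffCM mcoeffX; case: eqP; rewrite ?mulr1 ?mulr0.
Qed.

(** Induction on the size of the support. The coefficients at monomials with the same edge margins
    sum to zero, so each monomial of [f] has a partner with its margins, and by connectivity their
    difference lies in the ideal. *)
Lemma toric_eq0_ideal (f : poly_ring) : toric f = 0 ->
  (forall m, m \in msupp f -> (4 <= nondets (monomial_rows m))%N) -> ideal f.
Proof.
have [r] := ubnP (size (msupp f)); elim: r f => // r IH f; rewrite ltnS => fr tf nd.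
have [/eqP|[m mf]] : msupp f = [::] \/ exists m, m \in msupp f.
- by case: (msupp f) => [|m s]; [left | right; exists m; rewrite inE eqxx].
- by rewrite msupp_eq0 => /eqP->; exact: generated_ideal0.
have [m' m'f /andP[m'm /eqP Em]] : exists2 m', m' \in msupp f &
    (m' != m) && (rows_mnm (monomial_rows m') == rows_mnm (monomial_rows m)).
  apply/hasP/negPn/negP => /hasPn nm; have := mf; rewrite mcoeff_msupp => /eqP[].
  have := congr1 (mcoeff (rows_mnm (monomial_rows m))) tf.
  rewrite mcoeff0 mcoeff_toric big_mkcond (bigD1_seq m) ?msupp_uniq //= eqxx.
  rewrite big_seq_cond big1 ?addr0 // => l /andP[lf lm].
  by have := nm l lf; rewrite lm /= => /negbTE->.
(* The coefficient at [m] is moved to [m'], which is in the support already, so the support loses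
   [m] and gains nothing. *)
pose g := f - f@_m *: ('X_[m] - 'X_[m']).
have gE l : g@_l = f@_l - f@_m * ((m == l)%:R - (m' == l)%:R).
  by rewrite /g mcoeffB mcoeffZ mcoeffB !mcoeffX.
have sub : {subset msupp g <= rem m (msupp f)}.
  move=> l; rewrite !mcoeff_msupp mem_rem_uniq ?msupp_uniq // inE /= mcoeff_msupp gE.
  have [->|lm] := eqVneq l m; first by rewrite (negbTE m'm) subr0 mulr1 subrr eqxx.
  apply: contraNN => /eqP fl; rewrite fl.
  have /negbTE-> : m' != l.
    by apply: contraTneq m'f => ->; rewrite mcoeff_msupp fl eqxx.
  by rewrite subrr mulr0 subrr eqxx.
have Ig : ideal g.
  apply: IH.
  - apply: leq_trans fr; have := uniq_leq_size (msupp_uniq g) sub.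
    by rewrite size_rem //; case: (msupp f) mf.
  - rewrite /g rmorphB /= tf -mul_mpolyC rmorphM rmorphB /= !toric_monomial Em subrr.
    by rewrite mulr0 subrr.
  - by move=> l /sub/mem_rem; exact: nd.
have -> : f = g + (f@_m)%:MP * ('X_[m] - 'X_[m']) by rewrite mul_mpolyC subrK.
apply: generated_idealD Ig _; apply: generated_idealM; rewrite !monomial_rowsE.
apply/conn_ideal/edge_count_conn; last exact: nd.
by move=> j c jN; rewrite -!(rows_mnmE _ (Ordinal jN)) Em.
Qed.

(** [toric] takes values in an integral domain, so it kills [f] together with its power. *)
Lemma cycle_ideal_radical : radical_ideal ideal.
Proof.
move=> f j j0 If; apply: toric_eq0_ideal => [|m]; last exact: monomial_nondets If.
have := generated_ideal_ker toric_kills If.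
by rewrite rmorphXn /= => /eqP; rewrite expf_eq0 j0 => /eqP.
Qed.

End CycleIdeal.

Theorem theorem4p5 (N : nat) (hN : 4 <= N) :
  positive_margins_property (cycle_graph N) (binary N) /\
  (forall k : fieldType, radical_ideal (global_ideal (cycle_graph N) (binary N) k)).
Proof.
case: N hN => // n hN; split; first exact: cycle_positive_margins.
by move=> k; exact: cycle_ideal_radical.
Qed.
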